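(* Let $(X,d)$ be a separable metric space, $T\colon X\to X$ a Borel measurable map, and $\mu,\nu$ two $T$-invariant $T$-ergodic Borel probability measures on $X$. Assume $T$ is locally Lipschitz mod $\nu$ and $(s_n)_{n\ge1}$ is a nice scale sequence. Then $\phi(x,y)=\liminf_{n\to\infty}s_n\,d(T^nx,y)$ satisfies either $\phi=0$ for $\mu\times\nu$-a.e. $(x,y)$, or $\phi=\infty$ for $\mu\times\nu$-a.e. $(x,y)$.
   Context: A scale sequence is a sequence of positive reals $s_n\to\infty$. It is nice if $s_{n+1}\ge s_n$ for large $n$, $\liminf_n s_{2n}/s_n>1$, and $\sup_n s_{n+1}/s_n<\infty$. The dilation gauge is $D_T(x)=\limsup_{y\to x} d(Ty,Tx)/d(y,x)$ if $x$ is a limit point of $X$ and $0$ if $x$ is isolated; $T$ is locally Lipschitz mod $\nu$ if $D_T<\infty$ $\nu$-a.e. *)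

(* Defs.v *)
From HB Require Import structures.
From mathcomp Require Import all_boot all_order all_algebra.
From mathcomp Require Import all_classical all_reals all_analysis.
Set Implicit Arguments. Unset Strict Implicit. Unset Printing Implicit Defensive.
Import Order.TTheory GRing.Theory Num.Theory.
Local Open Scope classical_set_scope.
Local Open Scope ring_scope.

Section defs.
Context {R : realType} {X : Type}.
Variable dist : X -> X -> R.

Definition is_metric :=
  [/\ forall x y, 0 <= dist x y,
      forall x y, dist x y = 0 <-> x = y,
      forall x y, dist x y = dist y x &
      forall x y z, dist x z <= dist x y + dist y z].

Definition separable :=
  exists D : set X, countable D /\
    forall x (e : R), 0 < e -> exists2 y, D y & dist x y < e.

Definition metric_open (A : set X) :=
  forall x, A x -> exists2 r : R, 0 < r & [set y | dist x y < r] `<=` A.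

Definition borel_sets : set (set X) := <<s metric_open >>.

Definition limit_point (x : X) :=
  forall e : R, 0 < e -> exists y, y <> x /\ dist y x < e.

(* dilation gauge D_T(x) = limsup_{y -> x} d(Ty,Tx)/d(y,x) (0 at isolated points) *)
Definition dilation (T : X -> X) (x : X) : \bar R :=
  if `[< limit_point x >] then
    ereal_inf [set ereal_sup
                 [set ((dist (T y) (T x) / dist y x)%:E) | y in
                    [set y | 0 < dist y x /\ dist y x < delta]]
              | delta in [set delta : R | 0 < delta]]
  else 0%E.

(* nice scale sequence (indices n >= 1; the value s 0 is irrelevant) *)
Definition nice_scale (s : nat -> R) :=
  [/\ forall n, (1 <= n)%N -> 0 < s n,
      s @ \oo --> +oo,
      \forall n \near \oo, s n <= s n.+1,
      (1 < limn_einf (fun n => ((s (2 * n)%N / s n)%:E)))%E &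
      exists M : R, forall n, (1 <= n)%N -> s n.+1 / s n <= M].

End defs.

Definition phi {R : realType} {X : Type} (dist : X -> X -> R) (T : X -> X)
  (s : nat -> R) (x y : X) : \bar R :=
  limn_einf (fun n => ((s n * dist (iter n T x) y)%:E)).

(* Main.v *)
(* Fix y and let A(a) be the set of x with s_n d(T^n x, y) < a for infinitely
   many n. Since s is eventually nondecreasing, A(a) is forward invariant, so
   mu(A(a)) is 0 or 1. If s_{2n} >= rho s_n eventually, then mu(A(a)) = 0
   implies mu(A(rho a)) = 0: let G be the set of x with s_n d(T^n x, y) < a for
   some n >= N, which has small measure for N large. A hit of x at time n in
   the definition of A(rho a) puts T^j x in G for all n/2 <= j <= n - N, so the
   orbit of a point of A(rho a) spends nearly half of the time up to n in G, and
   the maximal inequality excludes this for almost every x. As rho > 1, either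
   all A(a) are null (and phi(., y) is infinite a.e.) or all A(a), a > 0, are
   full (and phi(., y) = 0 a.e.). The set of y of the second kind is forward
   invariant mod nu because phi(Tx, Ty) <= D_T(y) phi(x, y), so it is null or
   full, and Fubini concludes. *)
Require Import Defs.
From HB Require Import structures.
From mathcomp Require Import all_boot all_order all_algebra.
From mathcomp Require Import all_classical all_reals all_analysis.
From mathcomp Require Import measurable_realfun.
From mathcomp Require Import zify lra.
Import Order.TTheory GRing.Theory Num.Theory.
Local Open Scope classical_set_scope.
Local Open Scope ring_scope.

(** * Zero-one laws for forward invariant sets *)

Lemma measurable_iter (dX : measure_display) (X : measurableType dX)
  (T : X -> X) (mT : measurable_fun setT T) (n : nat) :
  measurable_fun setT (iter n T).
Proof.
elim: n => [|n IH]; first exact: measurable_id.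
exact: (measurableT_comp mT IH).
Qed.

Lemma measurable_preimage_iter (dX : measure_display) (X : measurableType dX)
  (T : X -> X) (mT : measurable_fun setT T) (n : nat) (A : set X) :
  measurable A -> measurable (iter n T @^-1` A).
Proof. by move=> mA; rewrite -[_ @^-1` _]setTI; exact: measurable_iter. Qed.

Lemma measure_preimage_iter (R : realType) (dX : measure_display)
  (X : measurableType dX) (mu : probability X R)
  (T : X -> X) (mT : measurable_fun setT T)
  (mu_inv : forall A, measurable A -> mu (T @^-1` A) = mu A)
  (n : nat) (A : set X) : measurable A -> mu (iter n T @^-1` A) = mu A.
Proof.
move=> mA; elim: n => [//|n IH].
rewrite -[RHS]IH -(mu_inv (iter n T @^-1` A)); last first.
  exact: measurable_preimage_iter.
by congr (mu _); apply/seteqP; split => x /=; rewrite -iterSr.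
Qed.

(** The preimages of [A] under the iterates increase and all have the measure of [A], while their
    union is exactly invariant. *)
Lemma ergodic_forward_invariant (R : realType) (dX : measure_display)
  (X : measurableType dX) (mu : probability X R)
  (T : X -> X) (mT : measurable_fun setT T)
  (mu_inv : forall A, measurable A -> mu (T @^-1` A) = mu A)
  (mu_erg : forall A, measurable A -> T @^-1` A = A ->
     mu A = 0%E \/ mu A = 1%E)
  (A : set X) : measurable A -> A `<=` T @^-1` A -> mu A = 0%E \/ mu A = 1%E.
Proof.
move=> mA AT; pose F n := iter n T @^-1` A.
have mF n : measurable (F n) by exact: measurable_preimage_iter.
have mUF : measurable (\bigcup_n F n) by exact: bigcupT_measurable.
have ndF : nondecreasing_seq F.
  by apply/nondecreasing_seqP => n; apply/subsetPset => x; exact: AT.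
have := nondecreasing_cvg_mu (mu := mu) mF mUF ndF.
have -> : mu \o F = cst (mu A).
  by apply/funext => n /=; exact: measure_preimage_iter.
move=> /(cvg_unique _ (cvg_cst _))-> //.
apply: mu_erg => //; apply/seteqP; split => x [n _ Fx].
  by exists n.+1 => //; rewrite /F /= -iterS iterSr.
by exists n => //; rewrite /F /= -iterSr iterS; exact: AT.
Qed.

(** The points of [A] that stay in [A] forever form an exactly forward invariant set [C]. Any other
    point of [A] has an iterate in the null part of [A] that [T] sends outside [A], so [C] has the
    measure of [A]. *)
Lemma ergodic_ae_forward_invariant (R : realType) (dX : measure_display)
  (X : measurableType dX) (mu : probability X R)
  (T : X -> X) (mT : measurable_fun setT T)
  (mu_inv : forall A, measurable A -> mu (T @^-1` A) = mu A)
  (mu_erg : forall A, measurable A -> T @^-1` A = A ->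
     mu A = 0%E \/ mu A = 1%E)
  (A : set X) : measurable A -> mu.-negligible (A `\` T @^-1` A) ->
  mu A = 0%E \/ mu A = 1%E.
Proof.
move=> mA NA; pose C := \bigcap_n (iter n T @^-1` A).
have mC : measurable C.
  by apply: bigcapT_measurable => n; exact: measurable_preimage_iter.
have mTA : measurable (T @^-1` A).
  exact: (measurable_preimage_iter _ _ _ mT 1).
have nD n : mu (iter n T @^-1` (A `\` T @^-1` A)) = 0%E.
  rewrite measure_preimage_iter//; last exact: measurableD.
  by apply/negligibleP => //; exact: measurableD.
have nAC : mu.-negligible (A `\` C).
  pose F n := iter n T @^-1` (A `\` T @^-1` A).
  have nF n : mu.-negligible (F n).
    apply/negligibleP; last exact: nD.
    by apply: measurable_preimage_iter => //; exact: measurableD.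
  apply: negligibleS (negligible_bigcup nF) => x [Ax nCx].
  apply: contrapT => nU; apply: nCx => n _ /=.
  elim: n => [//|n IH]; apply: contrapT => nT; apply: nU.
  by exists n.
have CA : C `<=` A by move=> x /(_ 0%N I).
have -> : mu A = mu C.
  rewrite (measureDI mu mA mC) (setIidr CA).
  have /negligibleP -> // := nAC; last exact: measurableD.
  by rewrite add0e.
apply: (ergodic_forward_invariant _ _ _ _ T) => // x Cx n _.
by have := Cx n.+1 I; rewrite /= -iterSr.
Qed.

(** * A covering argument and the maximal inequality *)

(** Walk up from [a]: step by one where [v] fails, otherwise jump over the block of length [n],
    whose at most [n] points of [v] are paid for by its points of [g]. The last block may overrun
    the window, by at most [L]. *)
Lemma density_cover (g v : pred nat) (c L : nat) :
  (forall j, v j -> exists n, [/\ (0 < n)%N, (n <= L)%N &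
     (n <= c * \sum_(j <= i < j + n) g i)%N]) ->
  forall K a, (\sum_(a <= i < a + K) v i <= c * \sum_(a <= i < a + K + L) g i)%N.
Proof.
move=> Hv; elim/ltn_ind => K IH a.
case: K IH => [|K] IH; first by rewrite addn0 big_geq.
have [va|nva] := boolP (v a); last first.
  rewrite big_ltn; last by lia.
  rewrite (negbTE nva) add0n -addSnnS.
  apply: leq_trans (IH K _ a.+1) _ => //.
  rewrite leq_mul2l; apply/orP; right.
  by rewrite [leqRHS](big_cat_nat (n := a.+1)) ?leq_addl//=; lia.
have [n [n0 nL nc]] := Hv a va.
have vle k b : (\sum_(b <= i < b + k) v i <= k)%N.
  rewrite -[leqRHS](addKn b) -[leqRHS]muln1 -sum_nat_const_nat.
  by apply: leq_sum => i _; exact: leq_b1.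
have [Kn|nK] := leqP K.+1 n.
  apply: leq_trans (vle _ _) (leq_trans Kn (leq_trans nc _)).
  rewrite leq_mul2l; apply/orP; right.
  by rewrite [leqRHS](big_cat_nat (n := a + n)) ?leq_addr//=; lia.
rewrite (big_cat_nat (n := a + n)) /=; [|lia|lia].
rewrite [X in (_ <= c * X)%N](big_cat_nat (n := a + n)) /=; [|lia|lia].
rewrite mulnDr leq_add//; first exact: leq_trans (vle _ _) nc.
have -> : (a + K.+1 = (a + n) + (K.+1 - n))%N by lia.
by apply: IH; lia.
Qed.

(** Integrating [density_cover] along orbits of length [K] gives [K mu(V) <= c (K + L) mu(G)]; the
    overrun [L] is negligible for large [K]. *)
Lemma maximal_density (R : realType) (dX : measure_display)
  (X : measurableType dX) (mu : probability X R)
  (T : X -> X) (mT : measurable_fun setT T)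
  (mu_inv : forall A, measurable A -> mu (T @^-1` A) = mu A)
  (c L : nat) (G V : set X) : measurable G -> measurable V ->
  (forall x, V x -> exists n, [/\ (0 < n)%N, (n <= L)%N &
     (n <= c * \sum_(0 <= i < n) (iter i T x \in G))%N]) ->
  fine (mu V) <= c%:R * fine (mu G).
Proof.
move=> mG mV HV.
pose N (A : set X) K (x : X) : R := (\sum_(0 <= i < K) (iter i T x \in A))%:R.
have NE A K : N A K = (fun x => \sum_(0 <= i < K) \1_(iter i T @^-1` A) x).
  apply/funext => x; rewrite /N natr_sum; apply: eq_bigr => i _.
  by rewrite indicE; congr (_%:R); rewrite !inE.
have mN A K : measurable A -> measurable_fun setT (N A K).
  move=> mA; rewrite NE; apply: measurable_sum => i.
  by apply: measurable_indic; exact: measurable_preimage_iter.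
have intN A K : measurable A ->
    (\int[mu]_x (N A K x)%:E = (K%:R * fine (mu A))%:E)%E.
  move=> mA; rewrite NE; under eq_integral do rewrite -sumEFin.
  rewrite ge0_integral_sum//; last first.
    move=> i; apply/measurable_EFinP; apply: measurable_indic.
    exact: measurable_preimage_iter.
  transitivity (\sum_(0 <= i < K) (fine (mu A))%:E)%E.
    apply: eq_bigr => i _; rewrite integral_indic//; last first.
      exact: measurable_preimage_iter.
    rewrite setIT fineK ?fin_num_measure//; exact: measure_preimage_iter.
  by rewrite sumEFin sumr_const_nat subn0 mulr_natl.
have ineq K : K%:R * fine (mu V) <= c%:R * ((K + L)%:R * fine (mu G)).
  rewrite -lee_fin -intN// EFinM -intN// -ge0_integralZl//; last 2 first.
    by apply/measurable_EFinP; exact: mN.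
    by move=> x _; rewrite lee_fin.
  apply: ge0_le_integral => //.
  - by move=> x _; rewrite lee_fin.
  - exact/measurable_EFinP/mN.
  - exact/measurable_funeM/measurable_EFinP/mN.
  move=> x _; rewrite -EFinM lee_fin -natrM ler_nat.
  apply: (density_cover (fun i => iter i T x \in G) (fun i => iter i T x \in V)
    c L _ K 0).
  move=> j /set_mem /HV [n [n0 nL nc]]; exists n; split => //.
  apply: leq_trans nc _; rewrite leq_mul2l; apply/orP; right.
  rewrite -[X in (_ <= \sum_(X <= _ < _) _)%N]add0n big_addn addKn.
  by apply: leq_sum => i _; rewrite iterD.
rewrite leNgt; apply/negP => lt.
set v := fine (mu V) in lt ineq; set g := fine (mu G) in lt ineq.
have d0 : 0 < v - c%:R * g by rewrite subr_gt0.
(* Beyond this bound, [K (v - c g)] exceeds [c L g], against [ineq]. *)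
have := archi_boundP (x := c%:R * L%:R * g / (v - c%:R * g)).
set K := Num.bound _.
have g0 : 0 <= g by exact: fine_ge0.
have -> : 0 <= c%:R * L%:R * g / (v - c%:R * g).
  by rewrite divr_ge0 ?mulr_ge0// ltW.
move=> /(_ isT); rewrite ltr_pdivrMr//.
have := ineq K; rewrite natrD; nra.
Qed.

(** * Events occurring infinitely often, lower limits and measurability *)

(** This set lies between [liminf u < a] and [liminf u <= a]. The type [Z] is [X] when the target
    point is fixed, and [X * X] in the final argument. *)
Definition io_lt {R : realType} {Z : Type} (u : nat -> Z -> R) (a : R) : set Z :=
  [set z | forall N, exists2 n, (N <= n)%N & u n z < a].

Lemma measurable_io_lt (R : realType) (dZ : measure_display)
  (Z : measurableType dZ) (u : nat -> Z -> R) (a : R) :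
  (forall n, measurable_fun setT (u n)) -> measurable (io_lt u a).
Proof.
move=> mu_; have -> : io_lt u a =
    \bigcap_N \bigcup_(n in [set n | (N <= n)%N]) [set z | u n z < a].
  apply/seteqP; split => z /= h N.
    by move=> _; have [n Nn ua] := h N; exists n.
  by have [n Nn ua] := h N I; exists n.
apply: bigcapT_measurable => N; apply: bigcup_measurable => n _.
have := measurable_fun_ltr (mu_ n) (measurable_cst a) measurableT.
by move=> /(_ [set true] I); rewrite setTI.
Qed.

Lemma limn_einf_eq0 (R : realType) (u : nat -> R) :
  (forall n, (1 <= n)%N -> 0 <= u n) ->
  (forall a : R, 0 < a -> forall N, exists2 n, (N <= n)%N & u n < a) ->
  limn_einf (fun n => (u n)%:E) = 0%E.
Proof.
move=> u0 ua; rewrite limn_einf_lim; apply/cvg_lim => //.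
(* From [n = 1] on, the tail infimum is itself 0; the term of index 0 has unknown sign. *)
apply: (@cvg_near_cst _ _ 0%E); near=> n.
apply/eqP; rewrite eq_le; apply/andP; split; last first.
  apply: le_ereal_inf_tmp => _ [k /= nk <-]; rewrite lee_fin u0//.
  by apply: leq_trans nk; near: n; exists 1%N.
apply/lee_addgt0Pr => e e0; rewrite add0e.
have [k nk uk] := ua e e0 n.
apply: ereal_inf_le; exists (u k)%:E; first by exists k.
by rewrite lee_fin ltW.
Unshelve. all: by end_near. Qed.

Lemma limn_einf_eqy (R : realType) (u : nat -> R) :
  (forall a : R, ~ forall N, exists2 n, (N <= n)%N & u n < a) ->
  limn_einf (fun n => (u n)%:E) = +oo%E.
Proof.
move=> ua; suff /cvg_limn_einf_sup[] : (u n)%:E @[n --> \oo] --> +oo%E by [].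
apply/cvgeyPge => a; have /existsNP[N HN] := ua a.
exists N => // n /= Nn; rewrite lee_fin leNgt; apply/negP => una.
by apply: HN; exists n.
Qed.

(** Separability puts the open set [dist < r] in the product sigma-algebra: by the triangle
    inequality it is the union, over [q] in a countable dense set, of the sets
    [dist q z.1 + dist q z.2 < r]. *)
Lemma measurable_dist (R : realType) (dX : measure_display)
  (X : measurableType dX) (dist : X -> X -> R)
  (hmetric : is_metric dist) (hsep : separable dist)
  (hborel : @measurable _ X = borel_sets dist) :
  measurable_fun setT (fun z : X * X => dist z.1 z.2).
Proof.
have [d0 _ dC dT] := hmetric; have [D [cD hD]] := hsep.
have mdist q : measurable_fun setT (dist q).
  apply: (measurability _ (RGenInftyO.measurableE R)) => _ [_ [r ->] <-].
  rewrite setTI hborel; apply: sub_sigma_algebra => x /=; rewrite in_itv/= => xr.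
  exists (r - dist q x); first by rewrite subr_gt0.
  by move=> y /= xy; rewrite in_itv/=; have := dT q x y; lra.
have mdist2 q : measurable_fun setT (fun z : X * X => dist q z.1 + dist q z.2).
  apply: measurable_funD.
    exact: (measurableT_comp (mdist q) measurable_fst).
  exact: (measurableT_comp (mdist q) measurable_snd).
apply: (measurability _ (RGenInftyO.measurableE R)) => _ [_ [r ->] <-].
rewrite setTI.
have -> : (fun z : X * X => dist z.1 z.2) @^-1` `]-oo, r[ =
    \bigcup_(q in D) ((fun z : X * X => dist q z.1 + dist q z.2) @^-1` `]-oo, r[).
  apply/seteqP; split => z /=.
    rewrite in_itv/= => zr.
    have [|q Dq qz] := hD z.1 ((r - dist z.1 z.2) / 2); first by lra.
    exists q => //=; rewrite in_itv/=.
    by have := dT q z.1 z.2; rewrite (dC q z.1); lra.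
  move=> [q Dq] /=; rewrite !in_itv/= => h.
  by have := dT z.1 q z.2; rewrite (dC z.1 q); lra.
rewrite bigcup_set_type; apply: countable_bigcupT_measurable.
  by rewrite (eq_countable (card_setT _)).
by move=> q; rewrite -[_ @^-1` _]setTI; apply: mdist2.
Qed.

(** * The dichotomy for a fixed target point *)

(** A hit of [x] at time [n.+1] is a hit of [T x] at time [n], where the scale is no larger. *)
Lemma io_lt_forward_invariant (R : realType) (X : Type) (T : X -> X)
  (s : nat -> R) (f : X -> R) (a : R) :
  (\forall n \near \oo, s n <= s n.+1) -> (forall x, 0 <= f x) ->
  let A := io_lt (fun n x => s n * f (iter n T x)) a in A `<=` T @^-1` A.
Proof.
move=> [N0 _ hN0] f0 /= x hx N.
have [[|n] Nn ua] := hx (maxn N N0).+1; first by lia.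
exists n; first by lia.
rewrite -iterSr; apply: le_lt_trans (ler_wpM2r (f0 _) _) ua.
by apply: hN0 => /=; lia.
Qed.

Lemma count_ge (g : pred nat) (n lo hi : nat) : (lo <= hi <= n)%N ->
  (forall j, (lo <= j < hi)%N -> g j) -> (hi - lo <= \sum_(0 <= i < n) g i)%N.
Proof.
move=> /andP[lohi hin] hg.
rewrite (big_cat_nat (n := lo)) //=; last by lia.
rewrite [X in (_ + X)%N](big_cat_nat (n := hi)) //=.
rewrite [X in (_ + (X + _))%N](_ : _ = hi - lo)%N; first by lia.
rewrite -[RHS]muln1 -sum_nat_const_nat.
by apply: eq_big_nat => i /hg ->.
Qed.

(** The maximal inequality only bounds the measure of [A (rho * a)] by 1/2, hence the conclusion
    [<> 1]; the zero-one law turns it into nullity. *)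
Lemma io_lt_scale (R : realType) (dX : measure_display)
  (X : measurableType dX) (mu : probability X R)
  (T : X -> X) (mT : measurable_fun setT T)
  (mu_inv : forall A, measurable A -> mu (T @^-1` A) = mu A)
  (s : nat -> R) (f : X -> R) (rho a : R) :
  measurable_fun setT f -> (forall x, 0 <= f x) -> 0 < rho ->
  (forall n, (1 <= n)%N -> 0 < s n) ->
  (\forall n \near \oo, s n <= s n.+1) ->
  (\forall n \near \oo, rho * s n <= s (2 * n)%N) ->
  let A := io_lt (fun n x => s n * f (iter n T x)) in
  mu (A a) = 0%E -> mu (A (rho * a)) <> 1%E.
Proof.
move=> mf f0 rho0 s0 [N1 _ hN1] [N2 _ hN2].
set u := fun n x => s n * f (iter n T x); move=> /= A0 A1.
have mu_ n : measurable_fun setT (u n).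
  apply: measurable_funM; first exact: measurable_cst.
  exact: (measurableT_comp mf (measurable_iter _ _ _ mT n)).
have mlt n b : measurable [set x | u n x < b].
  have := measurable_fun_ltr (mu_ n) (measurable_cst b) measurableT.
  by move=> /(_ [set true] I); rewrite setTI.
have smono m n : (N1 <= m)%N -> (m <= n)%N -> s m <= s n.
  move=> Nm; elim: n => [|n IH]; first by rewrite leqn0 => /eqP ->.
  rewrite leq_eqVlt => /orP[/eqP->//|]; rewrite ltnS => mn.
  by apply: le_trans (IH mn) _; apply: hN1 => /=; lia.
pose G N := \bigcup_(n in [set n | (N <= n)%N]) [set x | u n x < a].
have mG N : measurable (G N) by apply: bigcup_measurable.
have GE : \bigcap_N G N = io_lt u a.
  apply/seteqP; split => x h N.
    by have [n Nn ua] := h N I; exists n.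
  by move=> _; have [n Nn ua] := h N; exists n.
(* The bound 1/8 times the constant 4 of [VG] is 1/2. Taking [N] past [N1] and [N2] makes
   monotonicity and doubling available at every time from [N] on. *)
have [N [NN GN]] : exists N, (maxn N1 N2 < N)%N /\ fine (mu (G N)) < 8%:R^-1.
  have niG : nonincreasing_seq G.
    move=> m n mn; apply/subsetPset => x [k /= nk ua]; exists k => //=.
    exact: leq_trans nk.
  have fG : (mu (G 0%N) < +oo)%E by rewrite ltey_eq fin_num_measure.
  have mIG : measurable (\bigcap_n G n) by exact: bigcapT_measurable.
  have : mu \o G @ \oo --> (0%E : \bar R).
    by rewrite -A0 -GE; exact: nonincreasing_cvg_mu.
  move=> /fine_cvgP[_].
  move=> /cvgr_lt /(_ 8%:R^-1); rewrite invr_gt0 ltr0n => /(_ isT)[M _ hM].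
  exists (maxn M (maxn N1 N2).+1); split; first by lia.
  by apply: hM => /=; lia.
(* The cutoff [L] bounds the block lengths. Starting at [4 * N] leaves at least [n / 4] integers
   from [n - n./2] to [n - N], whence the constant 4 below. *)
pose V L := \bigcup_(n in [set n | (4 * N <= n <= L)%N]) [set x | u n x < rho * a].
have mV L : measurable (V L) by apply: bigcup_measurable.
have VG L : fine (mu (V L)) <= 4%:R * fine (mu (G N)).
  apply: (maximal_density _ _ _ _ _ mT mu_inv 4 L) => // x [n /= /andP[Nn nL] una].
  exists n; split => //; first by lia.
  have half : (2 * n./2 <= n)%N by lia.
  (* Seen from time [j], the hit at time [n] occurs after [n - j <= n / 2] steps,
     when the scale is smaller by the factor [rho]. *)
  suff hit j : (n - n./2 <= j < (n - N).+1)%N -> iter j T x \in G N.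
    have := count_ge (fun i => iter i T x \in G N) n (n - n./2) (n - N).+1.
    move=> /(_ _ hit) h; apply: leq_trans (leq_mul (leqnn 4) (h _)); lia.
  move=> /andP[lo hi]; apply/mem_set; exists (n - j)%N; first by rewrite /=; lia.
  rewrite /= /u -iterD subnK; last by lia.
  have rs : rho * s (n - j)%N <= s n.
    apply: le_trans (hN2 _ _) (smono _ _ _ _) => /=; lia.
  rewrite -(ltr_pM2l rho0) mulrA; apply: le_lt_trans una.
  exact: ler_wpM2r.
have ndV : nondecreasing_seq V.
  move=> m n mn; apply/subsetPset => x [k /= /andP[Nk km] uk].
  by exists k => //=; rewrite Nk (leq_trans km).
have mUV : measurable (\bigcup_L V L) by exact: bigcupT_measurable.
have UV1 : mu (\bigcup_L V L) = 1%E.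
  apply/eqP; rewrite eq_le probability_le1//= -A1; apply: le_measure.
  - by rewrite inE; apply: measurable_io_lt.
  - by rewrite inE.
  move=> x /(_ (4 * N)%N)[n Nn un]; exists n => //; exists n => //=.
  by rewrite Nn leqnn.
have : mu \o V @ \oo --> (1%E : \bar R).
  by rewrite -UV1; exact: nondecreasing_cvg_mu.
move=> /fine_cvgP[_].
move=> /cvgr_gt /(_ 2%:R^-1); have -> : 2%:R^-1 < 1 :> R by lra.
move=> /(_ isT)[L _ /(_ L (leqnn L))] /= hL.
have := VG L; lra.
Qed.

Lemma io_lt_sub (R : realType) (Z : Type) (u : nat -> Z -> R) (a b : R) :
  a <= b -> io_lt u a `<=` io_lt u b.
Proof.
by move=> ab z uz N; have [n Nn un] := uz N; exists n => //; exact: lt_le_trans ab.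
Qed.

(** One null level [a > 0] makes all levels [rho ^+ k * a] null, and these exceed every [b]. *)
Lemma io_lt_dichotomy (R : realType) (dX : measure_display)
  (X : measurableType dX) (mu : probability X R)
  (T : X -> X) (mT : measurable_fun setT T)
  (mu_inv : forall A, measurable A -> mu (T @^-1` A) = mu A)
  (mu_erg : forall A, measurable A -> T @^-1` A = A ->
     mu A = 0%E \/ mu A = 1%E)
  (s : nat -> R) (f : X -> R) (rho : R) :
  measurable_fun setT f -> (forall x, 0 <= f x) -> 1 < rho ->
  (forall n, (1 <= n)%N -> 0 < s n) ->
  (\forall n \near \oo, s n <= s n.+1) ->
  (\forall n \near \oo, rho * s n <= s (2 * n)%N) ->
  let A := io_lt (fun n x => s n * f (iter n T x)) in
  (forall a, mu (A a) = 0%E) \/ (forall a, 0 < a -> mu (A a) = 1%E).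
Proof.
move=> mf f0 rho1 s0 snd s2 A.
have mA a : measurable (A a).
  apply: measurable_io_lt => n; apply: measurable_funM; first exact: measurable_cst.
  exact: (measurableT_comp mf (measurable_iter _ _ _ mT n)).
have A01 a : mu (A a) = 0%E \/ mu (A a) = 1%E.
  apply: (ergodic_forward_invariant _ _ _ _ T) => //.
  exact: io_lt_forward_invariant.
have [|/existsNP[a /not_implyP[a0 Aa]]] :=
  pselect (forall a, 0 < a -> mu (A a) = 1%E); first by right.
left=> b; have Aa0 : mu (A a) = 0%E by case: (A01 a).
have Ak k : mu (A (rho ^+ k * a)) = 0%E.
  elim: k => [|k IH]; first by rewrite expr0 mul1r.
  case: (A01 (rho ^+ k.+1 * a)) => //; rewrite exprS -mulrA => A1.
  by have := io_lt_scale _ _ _ _ _ mT mu_inv s f rho _ mf f0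
    (lt_trans ltr01 rho1) s0 snd s2 IH.
have [k bk] : exists k, b <= rho ^+ k * a.
  exists (Num.bound `|b / ((rho - 1) * a)|).
  set k := Num.bound _.
  have k0 : `|b / ((rho - 1) * a)| < k%:R by exact: archi_boundP (normr_ge0 _).
  (* Bernoulli's inequality; [k] was chosen so that [k (rho - 1) a > b]. *)
  have bern : 1 + k%:R * (rho - 1) <= rho ^+ k.
    elim: k {k0} => [|k IH]; first by rewrite expr0; lra.
    have rho0 : 0 <= rho by lra.
    rewrite exprS -natr1; apply: le_trans (ler_wpM2l rho0 IH).
    by have := mulr_ge0 (ler0n R k) (sqr_ge0 (rho - 1)); lra.
  have ra0 : 0 < (rho - 1) * a by rewrite mulr_gt0// subr_gt0.
  have : b < k%:R * ((rho - 1) * a).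
    by rewrite -ltr_pdivrMr//; apply: le_lt_trans k0; exact: ler_norm.
  by nra.
apply/eqP; rewrite -measure_le0 -(Ak k); apply: le_measure; rewrite ?inE//.
exact: io_lt_sub.
Qed.

(** * Local consequences of the hypotheses, and null sets of the product *)

(** A lower limit above 1 has a tail infimum above 1, which serves as [rho]. *)
Lemma nice_scale_doubling (R : realType) (s : nat -> R) : nice_scale s ->
  exists2 rho : R, 1 < rho & \forall n \near \oo, rho * s n <= s (2 * n)%N.
Proof.
move=> [s0 _ _ + _]; rewrite limn_einf_lim.
have /cvg_lim -> // := @cvg_einfs_sup R (fun n => (s (2 * n)%N / s n)%:E).
move=> /ereal_sup_gt[_ [N _ <-]] hN.
have le n : (N <= n)%N ->
    (einfs (fun n => (s (2 * n)%N / s n)%:E) N <= (s (2 * n)%N / s n)%:E)%E.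
  by move=> Nn; apply: ereal_inf_lbound; exists n.
(* The tail infimum is finite: it exceeds 1 and is at most the real ratio at [N]. *)
case: (einfs _ N) hN le => [r| |//]; last by move=> _ /(_ N (leqnn N)).
rewrite lte_fin => r1 le; exists r => //; exists N.+1 => // n /= Nn.
by rewrite -ler_pdivlMr ?s0 -?lee_fin ?le//; lia.
Qed.

(** At a limit point, a finite upper limit bounds the quotients on some punctured ball; at an
    isolated point, a small ball contains only [y]. *)
Lemma dilation_lipschitz (R : realType) (X : Type) (dist : X -> X -> R)
  (T : X -> X) (y : X) : is_metric dist -> (dilation dist T y < +oo)%E ->
  exists delta K : R, [/\ 0 < delta, 0 < K &
    forall x, dist x y < delta -> dist (T x) (T y) <= K * dist x y].
Proof.
move=> [d0 deq _ _].
have dTT x : x = y -> dist (T x) (T y) = 0 by move=> ->; apply/deq.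
rewrite /dilation; case: asboolP => [_ /ereal_inf_lt[_ [delta /= delta0 <-]]|].
  set S := ereal_sup _ => Soo.
  (* The maximum with 1 makes the constant positive and also covers [S = -oo]. *)
  have SK : (S <= (Num.max 1 (fine S))%:E)%E.
    move: Soo; case: S => [r| |]//= _; last exact: leNye.
    by rewrite lee_fin le_max lexx orbT.
  exists delta, (Num.max 1 (fine S)); split=> //; first by rewrite lt_max ltr01.
  move=> x xy; have := d0 x y; rewrite le_eqVlt => /orP[/eqP xy0|xy0].
    by rewrite -xy0 mulr0 dTT//; apply/deq.
  rewrite -ler_pdivrMr// -lee_fin; apply: le_trans SK.
  by apply: ereal_sup_ubound; exists x.
move=> /existsNP[e /not_implyP[e0 ne]] _; exists e, 1; split=> // x xy.
rewrite mul1r; have -> : x = y by apply: contrapT => nxy; apply: ne; exists x.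
by rewrite dTT.
Qed.

(** Tonelli exchanges the [x]-sections defining the product measure for [y]-sections, to match the
    analysis at fixed [y]. *)
Lemma product_measure_null (R : realType) (d1 d2 : measure_display)
  (X : measurableType d1) (Y : measurableType d2)
  (mu : probability X R) (nu : probability Y R) (Z : set (X * Y)) :
  measurable Z -> {ae nu, forall y, mu (ysection Z y) = 0%E} ->
  (mu \x nu)%E Z = 0%E.
Proof.
move=> mZ Z0; transitivity (\int[mu]_x fubini_F nu (EFin \o \1_Z) x)%E.
  by rewrite indic_fubini_tonelli_FE.
rewrite indic_fubini_tonelli// indic_fubini_tonelli_GE//.
rewrite (ae_eq_integral (cst 0%E)) ?integral0//.
- exact: measurable_fun_ysection.
- by apply: filterS Z0 => y /= -> _.
Qed.

Lemma io_lt_image (R : realType) (X : Type) (dist : X -> X -> R) (T : X -> X)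
  (s : nat -> R) (x y : X) :
  is_metric dist -> (dilation dist T y < +oo)%E -> nice_scale s ->
  let u n (z : X * X) := s n * dist (iter n T z.1) z.2 in
  (forall a, 0 < a -> io_lt u a (x, y)) ->
  forall a, 0 < a -> io_lt u a (T x, T y).
Proof.
move=> hm /(dilation_lipschitz _ _ _ _ _ hm)[delta [K [delta0 K0 hK]]] hs u h a a0 N.
have [d0 _ _ _] := hm; have [s0 /cvgryPge /(_ 1)[N0 _ hN0] _ _ _] := hs.
(* Since [s n >= 1], the level [delta] brings the orbit point into the Lipschitz ball; [a / K]
   absorbs the Lipschitz constant. *)
have [|n Nn /= un] := h (Num.min delta (a / K)) _ (maxn N (maxn N0 1)).
  by rewrite lt_min delta0 divr_gt0.
have s1 : 1 <= s n by apply: hN0 => /=; lia.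
exists n; first by lia.
move: un; rewrite lt_min => /andP[und una].
rewrite /u /= -iterSr /=;
  apply: (@le_lt_trans _ _ (s n * (K * dist (iter n T x) y))).
  rewrite ler_pM2l ?hK//; last by apply: lt_le_trans s1.
  by apply: le_lt_trans und; rewrite ler_peMl.
by rewrite mulrCA mulrC -ltr_pdivlMr.
Qed.

(** * From fixed targets to the product space *)

Theorem theorem6p7 (R : realType) (dX : measure_display) (X : measurableType dX)
  (dist : X -> X -> R)
  (hmetric : is_metric dist) (hsep : separable dist)
  (hborel : @measurable _ X = borel_sets dist)
  (T : X -> X) (mT : measurable_fun setT T)
  (mu nu : probability X R)
  (mu_inv : forall A, measurable A -> mu (T @^-1` A) = mu A)
  (nu_inv : forall A, measurable A -> nu (T @^-1` A) = nu A)
  (mu_erg : forall A, measurable A -> T @^-1` A = A ->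
     mu A = 0%E \/ mu A = 1%E)
  (nu_erg : forall A, measurable A -> T @^-1` A = A ->
     nu A = 0%E \/ nu A = 1%E)
  (hlip : {ae nu, forall x, (dilation dist T x < +oo)%E})
  (s : nat -> R) (hs : nice_scale s) :
  {ae (mu \x nu)%E, forall z : X * X, phi dist T s z.1 z.2 = 0%E} \/
  {ae (mu \x nu)%E, forall z : X * X, phi dist T s z.1 z.2 = +oo%E}.
Proof.
have [d0 _ _ _] := hmetric; have [s0 _ snd _ _] := hs.
have [rho rho1 s2] := nice_scale_doubling _ _ hs.
pose u n (z : X * X) := s n * dist (iter n T z.1) z.2.
have mdist := measurable_dist _ _ _ _ hmetric hsep hborel.
have mu_ n : measurable_fun setT (u n).
  apply: measurable_funM; first exact: measurable_cst.
  have mTn : measurable_fun setT (fun z : X * X => (iter n T z.1, z.2)).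
    apply: measurable_fun_pair measurable_snd.
    exact: (measurableT_comp (measurable_iter _ _ _ mT n) measurable_fst).
  exact: (measurableT_comp mdist mTn).
have mS a : measurable (io_lt u a) by exact: measurable_io_lt.
(* [phi] vanishes on [Z0]; countably many levels keep it measurable. *)
pose Z0 := \bigcap_k io_lt u k.+1%:R^-1.
have mZ0 : measurable Z0 by exact: bigcapT_measurable.
have Z0E z : Z0 z <-> forall a, 0 < a -> io_lt u a z.
  split=> [Zz a a0|Zz k _]; last by apply: Zz; rewrite invr_gt0.
  have := Zz (Num.bound a^-1) I; apply: io_lt_sub.
  rewrite invf_ple ?posrE//; apply: le_trans (ltW (archi_boundP _)) _.
    by rewrite invr_ge0 ltW.
  by rewrite ler_nat.
(* [phi] is infinite off [Zoo], so [Zoo] is the exceptional set of the second alternative. *)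
pose Zoo := \bigcup_k io_lt u k%:R.
have mZoo : measurable Zoo by exact: bigcupT_measurable.
pose B := [set y | mu (ysection Z0 y) = 1%E].
have mB : measurable B.
  have := measurable_fun_ysection mu mZ0 measurableT (emeasurable_set1 1%E).
  by rewrite setTI.
have dich y : (forall a, mu (ysection (io_lt u a) y) = 0%E) \/
    (forall a, 0 < a -> mu (ysection (io_lt u a) y) = 1%E).
  have mdy : measurable_fun setT (dist^~ y).
    exact: (measurableT_comp mdist (measurable_pair2 y)).
  have := io_lt_dichotomy _ _ _ _ _ mT mu_inv mu_erg s _ rho mdy (d0^~ y) rho1
    s0 snd s2.
  have E a : ysection (io_lt u a) y =
      io_lt (fun n x => s n * dist (iter n T x) y) a.
    by apply/seteqP; split => x; rewrite ysectionE.
  by move=> /= [H|H]; [left => a|right => a a0]; rewrite E H.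
have BoffP y : ~ B y -> mu (ysection Zoo y) = 0%E.
  move=> nB; case: (dich y) => [H|H].
    rewrite ysection_bigcup; apply/negligibleP.
      by apply: bigcupT_measurable => k; exact: measurable_ysection.
    apply: negligible_bigcup => k.
    by apply/negligibleP; [exact: measurable_ysection|exact: H].
  exfalso; apply: nB; rewrite /B /=.
  have mZy : measurable (ysection Z0 y) by exact: measurable_ysection.
  suff muC : mu (~` ysection Z0 y) = 0%E.
    rewrite -[ysection Z0 y]setCK probability_setC; last exact: measurableC.
    by rewrite muC sube0.
  (* Every level [1 / (k + 1)] has full section at [y], so the complement is a countable union of
     null sets. *)
  have -> : ~` ysection Z0 y = \bigcup_k ~` ysection (io_lt u k.+1%:R^-1) y.
    rewrite -setC_bigcap ysectionE preimage_bigcap; congr (~` _).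
    by apply: eq_bigcapr => k _; rewrite ysectionE.
  have mSy k : measurable (ysection (io_lt u k.+1%:R^-1) y).
    exact: measurable_ysection.
  apply/negligibleP.
    by apply: bigcupT_measurable => k; exact: measurableC.
  have muC0 k : mu (~` ysection (io_lt u k.+1%:R^-1) y) = 0%E.
    by rewrite probability_setC// H ?invr_gt0// subee.
  apply: negligible_bigcup => k.
  by apply/negligibleP; [exact: measurableC|exact: muC0].
(* Where the dilation at [y] is finite, [T] maps the section of [Z0] at [y] into the one at [T y],
   which is then full by invariance of [mu]. *)
have BT : nu.-negligible (B `\` T @^-1` B).
  apply: negligibleS hlip => y [By nBT] /= ly; apply: nBT.
  have mTy : measurable (ysection Z0 (T y)) by exact: measurable_ysection.
  apply/eqP; rewrite eq_le probability_le1//= -By -(mu_inv _ mTy).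
  apply: le_measure; rewrite ?inE.
  - exact: measurable_ysection.
  - exact: (measurable_preimage_iter _ _ _ mT 1).
  move=> x; rewrite !ysectionE /= => /Z0E h; apply/Z0E.
  exact: io_lt_image.
have [B0|B1] := ergodic_ae_forward_invariant _ _ _ _ T mT nu_inv nu_erg B mB BT.
  right; exists Zoo; split=> //; first apply: product_measure_null => //.
    by exists B; split=> // y /= nZ; apply: contrapT => /BoffP.
  move=> z; apply: contra_notP => nZ; apply: limn_einf_eqy => a ha; apply: nZ.
  exists (Num.bound `|a|) => //; apply: (io_lt_sub _ _ _ a) => //.
  by apply: le_trans (ler_norm a) (ltW (archi_boundP (normr_ge0 _))).
left; exists (~` Z0); split; first exact: measurableC.
  apply: product_measure_null; first exact: measurableC.
  exists (~` B); split; first exact: measurableC.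
    by rewrite probability_setC// B1 subee.
  move=> y /= nZ By; apply: nZ.
  have -> : ysection (~` Z0) y = ~` ysection Z0 y.
    by apply/seteqP; split => x; rewrite /= !ysectionE.
  by rewrite probability_setC ?By ?subee//; exact: measurable_ysection.
move=> z; apply: contra_not => /Z0E hz; apply: limn_einf_eq0 => // n n1.
by rewrite mulr_ge0// ltW// s0.
Qed.
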